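(* Given a paraconsistent Kripke model $M=\langle W,R,V\rangle$, let $M_R$ be the topological model on $W$ with the same valuation $V$ whose closed sets are the downward closed subsets of $W$ with respect to $R$. Then for every $w\in W$ and formula $\varphi$, if $M,w\models\varphi$ then $M_R,w\models\varphi$.
   Context: Formulas are built from propositional variables using $\wedge$, negation $\sim$, and $\Box$ (dual $\Diamond$). A paraconsistent Kripke model $\langle W,R,V\rangle$ interprets $\wedge$ standardly, $w\models\Box\varphi$ iff $v\models\varphi$ for all $v$ with $wRv$, and $\sim\varphi:=\neg\Box\varphi$ (equivalently $\Diamond\neg\varphi$) with $\neg$ classical negation. A set $X\subseteq W$ is downward closed if $y\in X$ and $xRy$ imply $x\in X$. In the topological model with closed set topology $\tau$, $[p]=V(p)$, $[\varphi\wedge\psi]=[\varphi]\cap[\psi]$, $[\sim\varphi]=\mathsf{Clo}(W\setminus[\varphi])$, $[\Box\varphi]=\mathsf{Int}([\varphi])$, $[\Diamond\varphi]=\mathsf{Clo}([\varphi])$, with $\mathsf{Clo}$, $\mathsf{Int}$ computed in $\tau$.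
   Formalization: The relation R is additionally assumed reflexive and transitive; without this the claim fails, e.g. for W={w}, R empty, V(p) empty, where M,w ⊨ □p holds but Int([p]) is empty. *)

(* Defs.v *)
From HB Require Import structures.
From mathcomp Require Import all_boot.
From mathcomp Require Import boolp classical_sets topology.

Set Implicit Arguments.
Unset Strict Implicit.
Unset Printing Implicit Defensive.

Local Open Scope classical_set_scope.

(* The diamond is a constructor because it is the classical dual of the box,
   and classical negation is not a connective of the language. *)
Inductive formula (P : Type) : Type :=
| Var of P
| And of formula P & formula P
| Neg of formula P
| Box of formula P
| Dia of formula P.

Record kripke_model (P : Type) := KripkeModel {
  world :> Type;
  acc : world -> world -> Prop;
  kval : P -> set world
}.
Arguments acc {P M} _ _ : rename.
Arguments kval {P} M p _ : rename.

Fixpoint ksat (P : Type) (M : kripke_model P) (w : M) (phi : formula P) :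
    Prop :=
  match phi with
  | Var p => kval M p w
  | And a b => ksat w a /\ ksat w b
  | Neg a => ~ (forall v : M, acc w v -> ksat v a)
  | Box a => forall v : M, acc w v -> ksat v a
  | Dia a => exists2 v : M, acc w v & ksat v a
  end.

Record top_model (P : Type) := TopModel {
  space :> topologicalType;
  topval : P -> set space
}.
Arguments topval {P} M p _ : rename.

Fixpoint ext (P : Type) (T : topologicalType) (V : P -> set T)
    (phi : formula P) : set T :=
  match phi with
  | Var p => V p
  | And a b => ext V a `&` ext V b
  | Neg a => closure (~` ext V a)
  | Box a => interior (ext V a)
  | Dia a => closure (ext V a)
  end.

Definition tsat (P : Type) (M : top_model P) (w : M) (phi : formula P) : Prop :=
  ext (topval M) phi w.

Definition down_closed (W : Type) (R : W -> W -> Prop) (X : set W) : Prop :=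
  forall x y : W, X y -> R x y -> X x.

(* A copy of W that carries the topology whose closed sets are the downward
   closed ones. MathComp-Analysis builds a topology from its open sets, so these
   are declared to be the complements; see [closed_down_closed]. *)
Definition down_space (W : Type) (R : W -> W -> Prop) : Type := W.

Section DownSpace.
Variables (W : Type) (R : W -> W -> Prop).

HB.instance Definition _ := gen_eqMixin (down_space R).
HB.instance Definition _ := gen_choiceMixin (down_space R).

Definition down_open (A : set (down_space R)) : Prop := down_closed R (~` A).

Fact down_openT : down_open setT.
Proof. by move=> x y /(_ I). Qed.

Fact down_openI : setI_closed down_open.
Proof.
move=> A B oA oB x y nABy Rxy [Ax Bx]; apply: nABy; split.
- by apply: contrapT => nAy; exact: (oA x y nAy Rxy).
- by apply: contrapT => nBy; exact: (oB x y nBy Rxy).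
Qed.

Fact down_open_bigU (I : Type) (f : I -> set (down_space R)) :
  (forall i, down_open (f i)) -> down_open (\bigcup_i f i).
Proof.
move=> of_ x y nfy Rxy [i _ fix_]; apply: (of_ i x y) => // fiy.
by apply: nfy; exists i.
Qed.

HB.instance Definition _ := isOpenTopological.Build (down_space R)
  down_openT down_openI down_open_bigU.

Lemma closed_down_closed (X : set (down_space R)) :
  closed X <-> down_closed R X.
Proof. by rewrite -openC /open/= /down_open setCK. Qed.

End DownSpace.

Definition top_of_kripke (P : Type) (M : kripke_model P) : top_model P :=
  @TopModel P (down_space (@acc P M)) (@kval P M).

(* Main.v *)
Require Import Defs.
From mathcomp Require Import all_boot.
From mathcomp Require Import boolp classical_sets topology.

Local Open Scope classical_set_scope.

(* For a preorder [R], closure in [down_space R] is the Kripke diamond and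
   interior the Kripke box, so the two semantics agree clause by clause. *)

(** The points that see [A] form the least downward closed set containing [A]: reflexivity puts [A]
    inside it, transitivity makes it downward closed, and any downward closed superset of [A]
    absorbs it. So closure is the diamond; complementing gives interior as the box, and induction on
    formulas finishes. *)

Lemma down_space_closureE (W : Type) (R : W -> W -> Prop)
    (R_refl : forall x, R x x)
    (R_trans : forall x y z, R x y -> R y z -> R x z)
    (A : set (down_space R)) :
  closure A = [set x | exists2 y, R x y & A y].
Proof.
apply/seteqP; split => [|x [y Rxy Ay]].
- rewrite closureEbigcap; apply: bigcap_inf; split; last by move=> x Ax; exists x.
  apply/closed_down_closed => x y [z Ryz Az] Rxy.
  by exists z => //; exact: R_trans Ryz.
- have /closed_down_closed cA := @closed_closure _ A.
  by apply: cA Rxy; exact: subset_closure.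
Qed.

Lemma down_space_interiorE (W : Type) (R : W -> W -> Prop)
    (R_refl : forall x, R x x)
    (R_trans : forall x y z, R x y -> R y z -> R x z)
    (A : set (down_space R)) :
  interior A = [set x | forall y, R x y -> A y].
Proof.
rewrite -[interior A]setCK -closure_setC down_space_closureE //.
apply/seteqP; split => x /= RA.
- by move=> y Rxy; apply: contrapT => nAy; apply: RA; exists y.
- by case=> y /RA.
Qed.

(** An equality rather than an inclusion, since [Neg] reverses inclusions and the induction would
    not go through. *)
Lemma ext_top_of_kripkeE (P : Type) (M : kripke_model P)
    (R_refl : forall x : M, acc x x)
    (R_trans : forall x y z : M, acc x y -> acc y z -> acc x z)
    (phi : formula P) :
  ext (topval (top_of_kripke M)) phi = [set w : M | ksat w phi].
Proof.
elim: phi => [p|a IHa b IHb|a IHa|a IHa|a IHa] //=.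
- by rewrite IHa IHb.
(* What remains is the classical passage between a failing box and a successor refuting [a]. *)
- rewrite IHa down_space_closureE //; apply/seteqP; split => w /=.
  + by case=> v Rwv nav /(_ v Rwv).
  + by move/existsNP=> [v /not_implyP[Rwv nav]]; exists v.
- by rewrite IHa down_space_interiorE.
- by rewrite IHa down_space_closureE.
Qed.

Theorem theorem3p18 (P : Type) (M : kripke_model P)
    (R_refl : forall x : M, acc x x)
    (R_trans : forall x y z : M, acc x y -> acc y z -> acc x z)
    (w : M) (phi : formula P) :
  ksat w phi -> tsat (M := top_of_kripke M) w phi.
Proof. by rewrite /tsat ext_top_of_kripkeE. Qed.
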